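(* Let $N=2$. Suppose the Convexity Assumption and the Lipschitz Assumption (see context) hold. Let $T\ge1$, $\gamma>0$, and let $H_1,H_2\succ 0$ and $G\succ 0$ satisfy $H_i\succeq(L_{\mathbf x}+L_{\mathbf y})I$ for $i=1,2$ and $G\succeq L_{\mathbf y}I$. Let $(\bar{\mathbf x},\bar{\mathbf y})$ be the output of the SEG-ADMM algorithm after $T$ iterations. With $H=\mathrm{Diag}(H_1,H_2)$, for every $\rho>0$, $$\max_{\mathbf y\in\mathcal Y}\Phi(\bar{\mathbf x},\mathbf y)-\min_{\mathbf x\in\mathcal X,\,A\mathbf x=a}\Phi(\mathbf x,\bar{\mathbf y})+\rho\|A\bar{\mathbf x}-a\|\le\frac{\rho^2/\gamma+\gamma\|A_2\|^2D_{\mathcal X_2}^2+\|H\|D_{\mathcal X}^2+\|G\|D_{\mathcal Y}^2}{2T}.$$ Consequently it takes $T=\mathcal O(\epsilon^{-1})$ iterations to reach an $\epsilon$-saddle point; that is, there is a constant $C$ independent of $\epsilon$ (depending only on the problem data, $\gamma$, $H$, $G$) such that for every $\epsilon\in(0,1]$ some $T\le C\epsilon^{-1}$ makes the output $(\bar{\mathbf x},\bar{\mathbf y})$ an $\epsilon$-saddle point.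
   Context: **Problem.** $\min_{\mathbf x\in\mathcal X}\max_{\mathbf y\in\mathcal Y}\Phi(\mathbf x,\mathbf y):=\sum_{i=1}^N h_i(x_i,\mathbf y)+\Psi(\mathbf x,\mathbf y)$ subject to $A\mathbf x=a$, where $\mathbf x=(x_1,\dots,x_N)$, $\mathcal X=\mathcal X_1\times\cdots\times\mathcal X_N$, the sets $\mathcal X_i\subset\mathbb R^{d_i}$ and $\mathcal Y\subset\mathbb R^{d}$ are compact and convex, $A=[A_1,\dots,A_N]$ with $A_i\in\mathbb R^{n\times d_i}$, $a\in\mathbb R^n$, so $A\mathbf x=\sum_iA_ix_i$. $D_{\mathcal X_i}$ and $D_{\mathcal Y}$ are the diameters of $\mathcal X_i$ and $\mathcal Y$, and $D_{\mathcal X}=\sqrt{\sum_iD_{\mathcal X_i}^2}$. **Slater's condition** (standing): there is $(\hat{\mathbf x},\hat{\mathbf y})\in\mathrm{int}(\mathcal X)\times\mathrm{int}(\mathcal Y)$ with $A\hat{\mathbf x}=a$. **Notation.** $\|\cdot\|$ is the Euclidean norm of vectors and the spectral norm of matrices; $\|v\|_M^2=v^\top Mv$ for symmetric $M$; $\succ,\succeq$ denote the Loewner order on symmetric matrices. **Convexity Assumption.** For every $\mathbf x\in\mathcal X$, $\Phi(\mathbf x,\cdot)$ is concave and upper semicontinuous on $\mathcal Y$. For every $\mathbf y\in\mathcal Y$ and every $i$, $h_i(\cdot,\mathbf y)$ is convex and lower semicontinuous on $\mathcal X_i$. $\Phi$ is bounded on $\mathcal X\times\mathcal Y$. For every $\mathbf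 y\in\mathcal Y$, $\Psi(\cdot,\mathbf y)$ is smooth and convex on $\mathcal X$, and $\|\nabla_{\mathbf x}\Psi(\mathbf x,\mathbf y)-\nabla_{\mathbf x}\Psi(\mathbf x',\mathbf y)\|\le L_{\mathbf x}\|\mathbf x-\mathbf x'\|$ for all $\mathbf x,\mathbf x'\in\mathcal X$, $\mathbf y\in\mathcal Y$. **Lipschitz Assumption.** $\Phi(\mathbf x,\cdot)$ is differentiable and $\|\nabla_{\mathbf y}\Phi(\mathbf x,\mathbf y)-\nabla_{\mathbf y}\Phi(\mathbf x',\mathbf y')\|\le L_{\mathbf y}\sqrt{\|\mathbf x-\mathbf x'\|^2+\|\mathbf y-\mathbf y'\|^2}$ for all $\mathbf x,\mathbf x'\in\mathcal X$, $\mathbf y,\mathbf y'\in\mathcal Y$. **Linearized augmented Lagrangian.** $\mathcal L_\gamma(\mathbf x,\lambda;\tilde{\mathbf x},\tilde{\mathbf y})=\sum_{i=1}^Nh_i(x_i,\tilde{\mathbf y})+\langle\nabla_{\mathbf x}\Psi(\tilde{\mathbf x},\tilde{\mathbf y}),\mathbf x-\tilde{\mathbf x}\rangle-\langle\lambda,A\mathbf x-a\rangle+\frac\gamma2\|A\mathbf x-a\|^2$. **Prox-ADMM step.** Given $\mathbf x\in\mathcal X$, $\lambda\in\mathbb R^n$, $\mathbf y\in\mathcal Y$, $\gamma>0$, $H_i\succ0$, the output $(\mathbf x^+,\lambda^+)=\texttt{Prox-ADMM}(\mathbf x,\lambda;\mathbf y;\gamma,\{H_i\})$ is defined by: for $i=1,\dots,N$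 successively, $$x_i^+=\arg\min_{w_i\in\mathcal X_i}\mathcal L_\gamma\big((x_1^+,\dots,x_{i-1}^+,w_i,x_{i+1},\dots,x_N),\lambda;\mathbf x,\mathbf y\big)+\tfrac12\|w_i-x_i\|_{H_i}^2,$$ and then $\lambda^+=\lambda-\gamma(A\mathbf x^+-a)$. **SEG-ADMM algorithm.** Start from $\mathbf x^0\in\mathcal X$, $\mathbf y^0\in\mathcal Y$, $\lambda^0=0$, with $\gamma>0$, $G\succ0$, $H_i\succ0$. For $k=0,1,\dots$: (1) $\hat{\mathbf y}^{k+1}=\arg\min_{\mathbf y\in\mathcal Y}\frac12\|\mathbf y-[\mathbf y^k+G^{-1}\nabla_{\mathbf y}\Phi(\mathbf x^k,\mathbf y^k)]\|_G^2$; (2) $(\mathbf x^{k+1},\lambda^{k+1})=\texttt{Prox-ADMM}(\mathbf x^k,\lambda^k;\hat{\mathbf y}^{k+1};\gamma,\{H_i\})$; (3) $\mathbf y^{k+1}=\arg\min_{\mathbf y\in\mathcal Y}\frac12\|\mathbf y-[\mathbf y^k+G^{-1}\nabla_{\mathbf y}\Phi(\mathbf x^{k+1},\hat{\mathbf y}^{k+1})]\|_G^2$. The output after $T$ iterations is $\bar{\mathbf x}=\frac1T\sum_{k=1}^T\mathbf x^k$, $\bar{\mathbf y}=\frac1T\sum_{k=1}^{T}\hat{\mathbf y}^k$. **$\epsilon$-saddle point.** $(\bar{\mathbf x},\bar{\mathbf y})\in\mathcal X\times\mathcal Y$ is an $\epsilon$-saddle point if $\max_{\mathbf y\in\mathcal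 Y}\Phi(\bar{\mathbf x},\mathbf y)-\min_{\mathbf x\in\mathcal X,A\mathbf x=a}\Phi(\mathbf x,\bar{\mathbf y})\in[-\epsilon,\epsilon]$ and $\|A\bar{\mathbf x}-a\|\le\epsilon$. *)

(* Defs.v *)
From mathcomp Require Import all_boot all_order all_algebra.
From mathcomp Require Import all_classical all_reals all_analysis.

Set Implicit Arguments.
Unset Strict Implicit.
Unset Printing Implicit Defensive.

Import Order.TTheory GRing.Theory Num.Theory.
Import numFieldNormedType.Exports.

Local Open Scope classical_set_scope.
Local Open Scope ring_scope.

Section Euclidean.
Context {R : realType}.

Definition dotp n (u v : 'cV[R]_n) : R := \sum_(i < n) u i 0 * v i 0.

(* The library norm on matrices is the entrywise sup norm, hence this one. *)
Definition enorm n (v : 'cV[R]_n) : R := Num.sqrt (dotp v v).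

(* Spectral norm: the operator norm induced by the Euclidean norms. *)
Definition specnorm m n (M : 'M[R]_(m, n)) : R :=
  sup [set enorm (M *m v) | v in [set v : 'cV[R]_n | enorm v <= 1]].

(* [qnorm2 M v] is $\|v\|_M^2 = v^\top M v$. *)
Definition qnorm2 n (M : 'M[R]_n) (v : 'cV[R]_n) : R := dotp v (M *m v).

Definition posdefmx n (M : 'M[R]_n) : Prop :=
  M^T = M /\ forall v : 'cV[R]_n, v != 0 -> 0 < qnorm2 M v.

Definition possemidefmx n (M : 'M[R]_n) : Prop :=
  M^T = M /\ forall v : 'cV[R]_n, 0 <= qnorm2 M v.

(* Loewner order, for symmetric M and M'. *)
Definition loewner_le n (M M' : 'M[R]_n) : Prop := possemidefmx (M' - M).

Definition diameter n (S : set 'cV[R]_n) : R :=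
  sup [set enorm (u - v) | u in S & v in S].

(* [lower_semicontinuous] on [subspace S] only constrains f along S. *)
Definition lsc_on n (S : set 'cV[R]_n) (f : 'cV[R]_n -> R) : Prop :=
  @lower_semicontinuous (subspace S) R (fun u => (f u)%:E).

Definition usc_on n (S : set 'cV[R]_n) (f : 'cV[R]_n -> R) : Prop :=
  lsc_on S (fun u => - f u).

Definition concave_function n (S : set 'cV[R]_n) (f : 'cV[R]_n -> R) : Prop :=
  convex_function S (fun u => - f u).

(* Frechet differentiability relative to S: only values of f on S matter.
   For convex S with nonempty interior the gradient is unique, also at
   boundary points of S. *)
Definition is_gradient n (S : set 'cV[R]_n) (f : 'cV[R]_n -> R)
    (u g : 'cV[R]_n) : Prop :=
  forall e : R, 0 < e ->
    \forall v \near within S (nbhs u),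
      `|f v - f u - dotp g (v - u)| <= e * enorm (v - u).

Definition differentiable_on n (S : set 'cV[R]_n) (f : 'cV[R]_n -> R) : Prop :=
  forall u, S u -> exists g, is_gradient S f u g.

Definition gradient n (S : set 'cV[R]_n) (f : 'cV[R]_n -> R) (u : 'cV[R]_n) :
    'cV[R]_n :=
  xget 0 [set g | is_gradient S f u g].

Definition is_argmin n (S : set 'cV[R]_n) (f : 'cV[R]_n -> R)
    (u : 'cV[R]_n) : Prop :=
  S u /\ forall v, S v -> f u <= f v.

Definition is_max (E : set R) (m : R) : Prop := E m /\ ubound E m.
Definition is_min (E : set R) (m : R) : Prop := E m /\ lbound E m.

End Euclidean.

(* Two-block problem (N = 2); block vectors are stacked, x = col_mx x1 x2. *)
Record problem (R : realType) (d1 d2 d n : nat) := Problem {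
  X1 : set 'cV[R]_d1;
  X2 : set 'cV[R]_d2;
  Y : set 'cV[R]_d;
  h1 : 'cV[R]_d1 -> 'cV[R]_d -> R;
  h2 : 'cV[R]_d2 -> 'cV[R]_d -> R;
  Psi : 'cV[R]_(d1 + d2) -> 'cV[R]_d -> R;
  A1 : 'M[R]_(n, d1);
  A2 : 'M[R]_(n, d2);
  rhs : 'cV[R]_n
}.

Section Problem.
Context {R : realType} {d1 d2 d n : nat}.
Variable P : problem R d1 d2 d n.
Implicit Types (x : 'cV[R]_(d1 + d2)) (y : 'cV[R]_d) (lam : 'cV[R]_n).

Definition X : set 'cV[R]_(d1 + d2) :=
  [set x | X1 P (usubmx x) /\ X2 P (dsubmx x)].

Definition A : 'M[R]_(n, d1 + d2) := row_mx (A1 P) (A2 P).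

Definition residual x : 'cV[R]_n := A *m x - rhs P.

Definition hsum x y : R := h1 P (usubmx x) y + h2 P (dsubmx x) y.

Definition Phi x y : R := hsum x y + Psi P x y.

Definition gradx_Psi x y : 'cV[R]_(d1 + d2) := gradient X (Psi P ^~ y) x.
Definition grady_Phi x y : 'cV[R]_d := gradient (Y P) (Phi x) y.

Definition feasible : set 'cV[R]_(d1 + d2) := [set x | X x /\ A *m x = rhs P].

Definition diameterX : R :=
  Num.sqrt (diameter (X1 P) ^+ 2 + diameter (X2 P) ^+ 2).

Definition constraint_sets : Prop :=
  [/\ compact (X1 P) /\ convex_set (X1 P),
      compact (X2 P) /\ convex_set (X2 P) &
      compact (Y P) /\ convex_set (Y P)].

Definition slater : Prop :=
  exists x y, [/\ interior X x, interior (Y P) y & A *m x = rhs P].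

Definition convexity_assumption (Lx : R) : Prop :=
  [/\ forall x, X x -> concave_function (Y P) (Phi x) /\ usc_on (Y P) (Phi x),
      forall y, Y P y ->
        [/\ convex_function (X1 P) (h1 P ^~ y), lsc_on (X1 P) (h1 P ^~ y),
            convex_function (X2 P) (h2 P ^~ y) & lsc_on (X2 P) (h2 P ^~ y)],
      exists B : R, forall x y, X x -> Y P y -> `|Phi x y| <= B,
      forall y, Y P y ->
        differentiable_on X (Psi P ^~ y) /\ convex_function X (Psi P ^~ y) &
      forall x x' y, X x -> X x' -> Y P y ->
        enorm (gradx_Psi x y - gradx_Psi x' y) <= Lx * enorm (x - x')].

Definition lipschitz_assumption (Ly : R) : Prop :=
  (forall x, X x -> differentiable_on (Y P) (Phi x)) /\
  (forall x x' y y', X x -> X x' -> Y P y -> Y P y' ->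
    enorm (grady_Phi x y - grady_Phi x' y') <=
      Ly * Num.sqrt (enorm (x - x') ^+ 2 + enorm (y - y') ^+ 2)).

Definition lin_aug_lagrangian (gamma : R) x lam (xt : 'cV[R]_(d1 + d2))
    (yt : 'cV[R]_d) : R :=
  hsum x yt + dotp (gradx_Psi xt yt) (x - xt) - dotp lam (residual x)
    + gamma / 2 * enorm (residual x) ^+ 2.

Definition prox_admm (gamma : R) (H1 : 'M[R]_d1) (H2 : 'M[R]_d2)
    x lam y (xp : 'cV[R]_(d1 + d2)) (lamp : 'cV[R]_n) : Prop :=
  [/\ is_argmin (X1 P)
        (fun w => lin_aug_lagrangian gamma (col_mx w (dsubmx x)) lam x y
                  + 2^-1 * qnorm2 H1 (w - usubmx x))
        (usubmx xp),
      is_argmin (X2 P)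
        (fun w => lin_aug_lagrangian gamma (col_mx (usubmx xp) w) lam x y
                  + 2^-1 * qnorm2 H2 (w - dsubmx x))
        (dsubmx xp) &
      lamp = lam - gamma *: residual xp].

(* [w] is the G-metric projection onto Y of the ascent step from y along g. *)
Definition ascent_step (G : 'M[R]_d) y (g w : 'cV[R]_d) : Prop :=
  is_argmin (Y P) (fun v => 2^-1 * qnorm2 G (v - (y + invmx G *m g))) w.

(* A run of SEG-ADMM: iterates x^k, y^k, \hat y^k, lambda^k; the value
   [yh 0] is unused. *)
Definition seg_admm (gamma : R) (H1 : 'M[R]_d1) (H2 : 'M[R]_d2) (G : 'M[R]_d)
    (x : nat -> 'cV[R]_(d1 + d2)) (y yh : nat -> 'cV[R]_d)
    (lam : nat -> 'cV[R]_n) : Prop :=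
  [/\ X (x 0%N), Y P (y 0%N), lam 0%N = 0 &
    forall k : nat,
      [/\ ascent_step G (y k) (grady_Phi (x k) (y k)) (yh k.+1),
          prox_admm gamma H1 H2 (x k) (lam k) (yh k.+1)
            (x k.+1) (lam k.+1) &
          ascent_step G (y k) (grady_Phi (x k.+1) (yh k.+1)) (y k.+1)]].

Definition max_Phi x (M : R) : Prop := is_max [set Phi x y | y in Y P] M.
Definition min_Phi y (m : R) : Prop := is_min [set Phi x y | x in feasible] m.

Definition eps_saddle_point (eps : R) x y : Prop :=
  [/\ X x, Y P y,
      exists M m, [/\ max_Phi x M, min_Phi y m & - eps <= M - m <= eps] &
      enorm (residual x) <= eps].

End Problem.

(* Average of the iterates of index 1, ..., T. *)
Definition ergodic_mean (R : realType) m (T : nat) (u : nat -> 'cV[R]_m) :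
    'cV[R]_m :=
  (T%:R)^-1 *: \sum_(1 <= k < T.+1) u k.

(* Main.v *)
Require Import Defs.
From mathcomp Require Import all_boot all_order all_algebra.
From mathcomp Require Import all_classical all_reals all_analysis.
From mathcomp Require Import ring lra.

Import Order.TTheory GRing.Theory Num.Theory.
Import numFieldNormedType.Exports.

Local Open Scope classical_set_scope.
Local Open Scope ring_scope.

(** Fix a comparison point: a feasible [xs], some [ys] in [Y] and a multiplier
    [ls].  Along the run, the Lyapunov function [potential], a sum of squared
    distances from the current iterate to the comparison point, decreases at
    each iteration by at least the primal-dual gap
    [Phi x' ys - dotp ls (residual x') - Phi xs yh] ([potential_step]).
    Two estimates add up to this.

    - The extragradient pair [yh], [y'] satisfies the usual inequality with the
      metric [G] ([extragradient_step]).  Since [yh] uses the gradient at the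
      old [x], the estimate loses [Ly / 2] times the squared norm of [x' - x].
    - The two block minimizations satisfy variational inequalities, and the
      three-point identity turns them into differences of squared distances
      ([prox_admm_step]).  The second block being updated after the first one
      costs the product of [A2 (x2' - x2)] and the residual, which Young's
      inequality splits between two available negative squares.  The descent
      lemma for [Psi] loses [Lx / 2] times the squared norm of [x' - x].

    Both losses are absorbed by the proximal terms, because [H1] and [H2]
    dominate [Lx + Ly].  Summing over the iterations and applying Jensen's
    inequality bounds the gap at the ergodic means by the initial potential
    over [T] ([ergodic_gap]).  Taking for [ys] a maximizer, for [xs] a
    minimizer and for [ls] the vector of norm [rho] opposite to the residual of
    the mean gives the stated bound ([ergodic_bound]).

    For the complexity claim the duality gap must also be bounded below, as the
    mean need not be feasible.  No saddle point or multiplier is needed for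
    this: Slater's condition lets any point of [X] be moved to a feasible point
    at a cost proportional to its residual ([slater_penalty]), so the gap is at
    least [- c] times the residual.  The bound with [rho = c + 1] then controls
    the residual and the gap at once. *)

(** * Euclidean geometry *)

Section Euclidean_geometry.
Set Implicit Arguments.
Unset Strict Implicit.
Context {R : realType}.

Section Dot.
Context {n : nat}.
Implicit Types u v w : 'cV[R]_n.

Lemma dotpC u v : dotp u v = dotp v u.
Proof. by apply: eq_bigr => i _; rewrite mulrC. Qed.

Lemma dotpDl u v w : dotp (u + v) w = dotp u w + dotp v w.
Proof. by rewrite /dotp -big_split; apply: eq_bigr => i _; rewrite mxE mulrDl. Qed.

Lemma dotpZl a u v : dotp (a *: u) v = a * dotp u v.
Proof. by rewrite /dotp mulr_sumr; apply: eq_bigr => i _; rewrite mxE mulrA. Qed.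

Lemma dotpDr u v w : dotp w (u + v) = dotp w u + dotp w v.
Proof. by rewrite !(dotpC w) dotpDl. Qed.

Lemma dotpZr a u v : dotp v (a *: u) = a * dotp v u.
Proof. by rewrite !(dotpC v) dotpZl. Qed.

Lemma dotpNl u v : dotp (- u) v = - dotp u v.
Proof. by rewrite -scaleN1r dotpZl mulN1r. Qed.

Lemma dotpNr u v : dotp v (- u) = - dotp v u.
Proof. by rewrite !(dotpC v) dotpNl. Qed.

Lemma dotp0 u : dotp u 0 = 0.
Proof. by rewrite -(scale0r 0) dotpZr mul0r. Qed.

Definition dotpE := (dotpDl, dotpDr, dotpNl, dotpNr, dotpZl, dotpZr).

Lemma dotp_ge0 u : 0 <= dotp u u.
Proof. by apply: sumr_ge0 => i _; rewrite -expr2 sqr_ge0. Qed.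

Lemma enorm_sqr u : enorm u ^+ 2 = dotp u u.
Proof. by rewrite sqr_sqrtr // dotp_ge0. Qed.

Lemma enorm_ge0 u : 0 <= enorm u.
Proof. exact: sqrtr_ge0. Qed.

Lemma enorm0 : enorm (0 : 'cV[R]_n) = 0.
Proof. by rewrite /enorm dotp0 sqrtr0. Qed.

Lemma enormZ a u : enorm (a *: u) = `|a| * enorm u.
Proof. by rewrite /enorm !dotpE mulrA -expr2 sqrtrM ?sqr_ge0 // sqrtr_sqr. Qed.

Lemma enormN u : enorm (- u) = enorm u.
Proof. by rewrite /enorm !dotpE opprK. Qed.

Lemma enorm_distC u v : enorm (u - v) = enorm (v - u).
Proof. by rewrite -enormN opprB. Qed.

Lemma norm_le_enorm u : `|u| <= enorm u.
Proof.
rewrite [leLHS]/Num.norm /= mx_normrE; apply: bigmax_le; first exact: enorm_ge0.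
move=> [i j] _ /=; rewrite (ord1 j) -sqrtr_sqr ler_wsqrtr // expr2.
by rewrite /dotp (bigD1 i) //= lerDl; apply: sumr_ge0 => k _; rewrite -expr2 sqr_ge0.
Qed.

Lemma enorm_le_norm u : enorm u <= Num.sqrt n%:R * `|u|.
Proof.
rewrite -(ger0_norm (normr_ge0 u)) -sqrtr_sqr -sqrtrM ?ler0n // ler_wsqrtr //.
rewrite /dotp -[n in n%:R]card_ord -sum1_card natr_sum mulr_suml.
apply: ler_sum => i _; rewrite mul1r -expr2 -real_normK ?num_real //.
rewrite lerXn2r ?nnegrE //.
rewrite [leRHS]/Num.norm /= mx_normrE.
exact: (le_bigmax _ (fun ij : 'I_n * 'I_1 => `|u ij.1 ij.2|) (i, 0)).
Qed.

Lemma enorm_eq0 u : enorm u = 0 -> u = 0.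
Proof.
move=> u0; apply/eqP; rewrite -normr_eq0 eq_le normr_ge0 andbT -[leRHS]u0.
exact: norm_le_enorm.
Qed.

Lemma cauchy_schwarz u v : dotp u v <= enorm u * enorm v.
Proof.
have [u0|u0] := eqVneq (enorm u) 0.
  by rewrite u0 (enorm_eq0 u0) dotpC dotp0 mul0r.
have {}u0 : 0 < enorm u by rewrite lt_neqAle eq_sym u0 enorm_ge0.
have := dotp_ge0 (enorm v *: u - enorm u *: v).
rewrite !dotpE (dotpC v u) -!enorm_sqr.
have [v0|v0] := eqVneq (enorm v) 0.
  by rewrite (enorm_eq0 v0) dotp0 enorm0 mulr0.
have {}v0 : 0 < enorm v by rewrite lt_neqAle eq_sym v0 enorm_ge0.
move=> h; have uv0 : 0 < enorm u * enorm v by rewrite mulr_gt0.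
rewrite -(ler_pM2l uv0); lra.
Qed.

Lemma enorm_triangle u v : enorm (u + v) <= enorm u + enorm v.
Proof.
rewrite -(ler_pXn2r (n := 2)) ?nnegrE ?addr_ge0 ?enorm_ge0 //.
rewrite sqrrD !enorm_sqr !dotpE (dotpC v u).
have := cauchy_schwarz u v; lra.
Qed.

(** Young's inequality. *)
Lemma dotp_young u v : dotp u v <= (dotp u u + dotp v v) / 2.
Proof. by have := dotp_ge0 (u - v); rewrite !dotpE (dotpC v u); lra. Qed.

Lemma mulr_young (L a b : R) : 0 <= L -> L * a * b <= L / 2 * (a ^+ 2 + b ^+ 2).
Proof. by move=> L0; have := mulr_ge0 L0 (sqr_ge0 (a - b)); lra. Qed.

Lemma dotp_abs u v : `|dotp u v| <= enorm u * enorm v.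
Proof.
rewrite ler_norml cauchy_schwarz andbT lerNl -dotpNl -(enormN u).
exact: cauchy_schwarz.
Qed.

(** The topology of ['cV[R]_n] comes from the sup norm; Euclidean balls are also
    a basis of neighbourhoods. *)
Lemma nbhs_enormP (u : 'cV[R]_n) (V : set 'cV[R]_n) :
  nbhs u V <-> exists2 e : R, 0 < e & forall v, enorm (v - u) < e -> V v.
Proof.
have nP := @nbhs_normP R 'cV[R]_n u V.
split=> [/nP[/= e e0 eV]|[e e0 eV]]; last apply/nP.
  exists e => // v vu; apply: eV => /=; rewrite distrC.
  exact: le_lt_trans (norm_le_enorm _) vu.
exists (e / (Num.sqrt n%:R + 1)) => /=.
  by rewrite divr_gt0 // ltr_wpDl ?sqrtr_ge0.
move=> v; rewrite /= distrC ltr_pdivlMr ?ltr_wpDl ?sqrtr_ge0 // => vu.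
apply: eV; apply: le_lt_trans vu; apply: le_trans (enorm_le_norm _) _.
by rewrite mulrC ler_wpM2l // lerDl.
Qed.

End Dot.

Section Matrices.

Lemma dotp_col_mx m n (a b : 'cV[R]_m) (c e : 'cV[R]_n) :
  dotp (col_mx a c) (col_mx b e) = dotp a b + dotp c e.
Proof.
rewrite /dotp big_split_ord /=; congr (_ + _); apply: eq_bigr => i _.
  by rewrite !col_mxEu.
by rewrite !col_mxEd.
Qed.

Lemma dotp_mulmx m n (M : 'M[R]_(m, n)) u v :
  dotp (M *m u) v = dotp u (M^T *m v).
Proof.
have dE k (a b : 'cV[R]_k) : dotp a b = (a^T *m b) 0 0.
  by rewrite mxE; apply: eq_bigr => i _; rewrite mxE.
by rewrite !dE trmx_mul mulmxA.
Qed.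

Lemma qnorm2D n (M : 'M[R]_n) u v : M^T = M ->
  qnorm2 M (u + v) = qnorm2 M u + 2 * dotp (M *m u) v + qnorm2 M v.
Proof.
move=> sM; rewrite /qnorm2 mulmxDr !dotpE (dotpC v) (dotp_mulmx M u) sM.
ring.
Qed.

Lemma qnorm2Z n (M : 'M[R]_n) a u : qnorm2 M (a *: u) = a ^+ 2 * qnorm2 M u.
Proof. by rewrite /qnorm2 -scalemxAr !dotpE; ring. Qed.

(** Three-point identity. *)
Lemma dotp_three_point n (M : 'M[R]_n) u v w : M^T = M ->
  dotp (M *m (u - v)) (w - u) =
  (qnorm2 M (w - v) - qnorm2 M (w - u) - qnorm2 M (u - v)) / 2.
Proof.
move=> sM.
have -> : w - v = (u - v) + (w - u) by rewrite [RHS]addrC addrA subrK.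
by rewrite qnorm2D //; field.
Qed.

Lemma possemidef_loewner n c (M : 'M[R]_n) v :
  loewner_le c%:M M -> c * dotp v v <= qnorm2 M v.
Proof.
move=> [_ /(_ v)]; rewrite /qnorm2 mulmxBl mul_scalar_mx !dotpE; lra.
Qed.

Lemma posdef_qnorm2_ge0 n (M : 'M[R]_n) v : posdefmx M -> 0 <= qnorm2 M v.
Proof.
move=> [_ M0]; have [->|/M0/ltW //] := eqVneq v 0.
by rewrite /qnorm2 mulmx0 dotp0.
Qed.

Lemma posdef_unitmx n (M : 'M[R]_n) : posdefmx M -> M \in unitmx.
Proof.
move=> [sM M0]; rewrite -row_free_unit -kermx_eq0.
apply/eqP/row_matrixP => i; rewrite row0.
apply/eqP/negPn/negP => ri0.
have rM : row i (kermx M) *m M = 0 by apply/sub_kermxP; exact: row_sub.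
have Mr : M *m (row i (kermx M))^T = 0.
  by rewrite -[X in X *m _]sM -trmx_mul rM trmx0.
have /M0 : (row i (kermx M))^T != 0.
  by apply: contra ri0 => /eqP e; rewrite -[row i _]trmxK e trmx0.
by rewrite /qnorm2 Mr dotp0 ltxx.
Qed.

(** A bound for the operator norm is needed before its supremum is known to be
    meaningful; the Frobenius norm provides one. *)
Lemma enorm_mulmx_bounded m n (M : 'M[R]_(m, n)) :
  exists2 c : R, 0 <= c & forall v, enorm (M *m v) <= c * enorm v.
Proof.
exists (Num.sqrt (\sum_(i < m) dotp (row i M)^T (row i M)^T)).
  exact: sqrtr_ge0.
move=> v; rewrite /enorm -sqrtrM; last by apply: sumr_ge0 => i _; exact: dotp_ge0.
rewrite ler_wsqrtr // {1}/dotp mulr_suml; apply: ler_sum => i _.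
have -> : (M *m v) i 0 = dotp (row i M)^T v.
  by rewrite mxE; apply: eq_bigr => j _; rewrite !mxE.
rewrite -expr2 -real_normK ?num_real // -!enorm_sqr -exprMn.
by rewrite lerXn2r ?nnegrE ?mulr_ge0 ?enorm_ge0 // dotp_abs.
Qed.

Lemma enorm_mulmx m n (M : 'M[R]_(m, n)) v :
  enorm (M *m v) <= specnorm M * enorm v.
Proof.
have [c c0 Mc] := enorm_mulmx_bounded M.
have [/enorm_eq0 ->|v0] := eqVneq (enorm v) 0.
  by rewrite mulmx0 !enorm0 mulr0.
have {}v0 : 0 < enorm v by rewrite lt_neqAle eq_sym v0 enorm_ge0.
rewrite -ler_pdivrMr // mulrC.
have -> : (enorm v)^-1 * enorm (M *m v) = enorm (M *m ((enorm v)^-1 *: v)).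
  by rewrite -scalemxAr enormZ ger0_norm // invr_ge0 enorm_ge0.
apply: ub_le_sup.
  exists c => _ [w w1 <-]; apply: le_trans (Mc w) _.
  by rewrite ler_piMr.
exists ((enorm v)^-1 *: v) => //=.
by rewrite enormZ ger0_norm ?invr_ge0 ?enorm_ge0 // mulVf // gt_eqF.
Qed.

Lemma specnorm_ge0 m n (M : 'M[R]_(m, n)) : 0 <= specnorm M.
Proof.
have [c c0 Mc] := enorm_mulmx_bounded M.
apply: ub_le_sup.
  exists c => _ [w w1 <-]; apply: le_trans (Mc w) _.
  by rewrite ler_piMr.
by exists 0; rewrite /= ?mulmx0 ?enorm0.
Qed.

Lemma qnorm2_le n (M : 'M[R]_n) v D : enorm v <= D ->
  qnorm2 M v <= specnorm M * D ^+ 2.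
Proof.
move=> vD; apply: le_trans (cauchy_schwarz _ _) _.
have v0 := enorm_ge0 v.
apply: (@le_trans _ _ (enorm v * (specnorm M * enorm v))).
  by rewrite ler_wpM2l // enorm_mulmx.
rewrite mulrCA -expr2 ler_wpM2l ?specnorm_ge0 // lerXn2r ?nnegrE //.
exact: le_trans vD.
Qed.

Lemma diameter_ge n (S : set 'cV[R]_n) u v :
  compact S -> S u -> S v -> enorm (u - v) <= diameter S.
Proof.
move=> cS Su Sv; apply: ub_le_sup; last by exists u => //; exists v.
have [M [_ SM]] := compact_bounded cS.
have {}SM w : S w -> `|w| <= `|M| + 1.
  by apply: SM; rewrite (le_lt_trans (ler_norm M)) // ltrDl.
exists (Num.sqrt n%:R * ((`|M| + 1) + (`|M| + 1))) => _ [a Sa [b Sb <-]].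
apply: le_trans (enorm_le_norm _) _; rewrite ler_wpM2l ?sqrtr_ge0 //.
by apply: le_trans (ler_normB _ _) _; rewrite lerD // SM.
Qed.

End Matrices.

End Euclidean_geometry.

(** * Convex functions, gradients and minimizers *)

Section Convex_analysis.
Set Implicit Arguments.
Unset Strict Implicit.
Context {R : realType} {n : nat}.
Implicit Types (S K : set 'cV[R]_n) (f : 'cV[R]_n -> R) (u v g : 'cV[R]_n).

(** Convexity of [f] on [S], with the segment parametrized from its base point
    [u], which is the form used with gradients at [u]. *)
Definition below_chords S f : Prop := forall u v (t : R),
  S u -> S v -> 0 <= t <= 1 -> f (u + t *: (v - u)) <= f u + t * (f v - f u).

Lemma convex_segment S u v (t : R) :
  convex_set S -> S u -> S v -> 0 <= t <= 1 -> S (u + t *: (v - u)).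
Proof.
move=> cS Su Sv /andP[t0 t1].
have := cS v u (Itv01 t0 t1); rewrite !inE => /(_ Sv Su).
congr (S _); rewrite /conv /= /unstable.onem.
by rewrite scalerBl scale1r scalerBr addrCA.
Qed.

Lemma convex_below_chords S f : convex_function S f -> below_chords S f.
Proof.
move=> cf u v t Su Sv /andP[t0 t1].
have := cf (Itv01 t0 t1) v u; rewrite !inE => /(_ Sv Su).
rewrite convRE /= /conv /= /unstable.onem => h.
have -> : u + t *: (v - u) = t *: v + (1 - t) *: u.
  by rewrite scalerBl scale1r scalerBr addrCA.
apply: le_trans h _; rewrite le_eqVlt; apply/orP; left; apply/eqP; ring.
Qed.

Lemma below_chordsD S f1 f2 :
  below_chords S f1 -> below_chords S f2 ->
  below_chords S (fun u => f1 u + f2 u).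
Proof.
move=> c1 c2 u v t Su Sv t01.
by have := c1 _ _ _ Su Sv t01; have := c2 _ _ _ Su Sv t01; lra.
Qed.

(** First-order characterization of convexity. *)
Lemma below_chords_gradient S f u v g :
  convex_set S -> below_chords S f -> is_gradient S f u g -> S u -> S v ->
  f u + dotp g (v - u) <= f v.
Proof.
move=> cS cf fg Su Sv; rewrite -lerBrDl.
apply/ler_addgt0Pr => e e0.
have N0 : 0 < enorm (v - u) + 1 by rewrite ltr_wpDl ?enorm_ge0.
have /fg : 0 < e / (enorm (v - u) + 1) by rewrite divr_gt0.
move=> /nbhs_enormP[d d0 dP].
(* A step small enough to stay in the neighbourhood of [u] where the gradient
   estimate applies. *)
pose t := Num.min 1 (d / (enorm (v - u) + 1) / 2).
have t0 : 0 < t by rewrite lt_min ltr01 /= !divr_gt0.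
have t1 : 0 <= t <= 1 by rewrite ltW //= ge_min lexx.
have tN : t * enorm (v - u) < d.
  have : t <= d / (enorm (v - u) + 1) / 2 by rewrite ge_min lexx orbT.
  rewrite -mulrA -invfM ler_pdivlMr ?mulr_gt0 // => td.
  apply: lt_le_trans td; rewrite ltr_pM2l //.
  have := enorm_ge0 (v - u); lra.
have := dP (u + t *: (v - u)); rewrite addrAC subrr add0r enormZ gtr0_norm //.
move=> /(_ tN (convex_segment cS Su Sv t1)); rewrite dotpZr.
have := cf _ _ _ Su Sv t1; set w := u + _ => fw.
rewrite ler_norml => /andP[+ _].
have : e / (enorm (v - u) + 1) * (t * enorm (v - u)) <= t * e.
  rewrite mulrCA ler_wpM2l ?(ltW t0) // mulrAC ler_pdivrMr // ler_wpM2l ?(ltW e0) //.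
  by rewrite lerDl.
move: (_ / _ * _) => r re rf; rewrite -(ler_pM2l t0); lra.
Qed.

(** Descent lemma.  Convexity and the Lipschitz bound give the inequality with
    constant [L] instead of [L / 2]; splitting the segment at its midpoint
    turns a constant [c] into [c / 2 + L / 4], whose fixed point is [L / 2]. *)
Lemma descent_lemma S f (gr : 'cV[R]_n -> 'cV[R]_n) (L : R) u v :
  convex_set S -> below_chords S f ->
  (forall w, S w -> is_gradient S f w (gr w)) ->
  (forall w w', S w -> S w' -> enorm (gr w - gr w') <= L * enorm (w - w')) ->
  S u -> S v ->
  f v <= f u + dotp (gr u) (v - u) + L / 2 * dotp (v - u) (v - u).
Proof.
move=> cS cf grP grL Su Sv.
have lip w w' z (a : R) : S w -> S w' -> 0 <= a -> z = a *: (w - w') ->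
    dotp (gr w - gr w') z <= a * L * dotp (w - w') (w - w').
  move=> Sw Sw' a0 ->; rewrite dotpZr -mulrA ler_wpM2l //.
  apply: le_trans (cauchy_schwarz _ _) _; rewrite -enorm_sqr expr2 mulrA.
  by rewrite ler_wpM2r ?enorm_ge0 // grL.
have step k : forall w z, S w -> S z ->
    f z <= f w + dotp (gr w) (z - w)
      + (L / 2 + L / 2 ^+ k.+1) * dotp (z - w) (z - w).
  elim: k => [|k IH] w z Sw Sz.
    have := below_chords_gradient cS cf (grP z Sz) Sz Sw.
    have := lip z w (z - w) 1 Sz Sw ler01; rewrite scale1r => /(_ erefl).
    by rewrite -(opprB z w) !dotpE; lra.
  pose m := w + 2^-1 *: (z - w).
  have Sm : S m by apply: convex_segment => //; apply/andP; split; lra.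
  have mw : m - w = 2^-1 *: (z - w) by rewrite /m addrAC subrr add0r.
  have zm : z - m = 2^-1 *: (z - w).
    have {1}-> : z = w + 2^-1 *: (z - w) + 2^-1 *: (z - w).
      by rewrite -addrA -scalerDl -div1r -splitr scale1r addrC subrK.
    by rewrite /m addrAC subrr add0r.
  have := IH w m Sw Sm; have := IH m z Sm Sz.
  have := lip m w (z - m) 1 Sm Sw ler01; rewrite zm mw scale1r => /(_ erefl).
  rewrite ?(zm, mw); move: (z - w) => d.
  rewrite !dotpE (exprS 2 k.+1) invfM; set p := (2 ^+ k.+1)^-1.
  lra.
rewrite -subr_le0; set q := dotp (v - u) (v - u).
rewrite leNgt; apply/negP; set x := (X in 0 < X) => x0.
have xk k : x * 2 ^+ k.+1 <= L * q.
  rewrite -ler_pdivlMr ?exprn_gt0 //.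
  have := step k u v Su Sv; rewrite -/q /x; lra.
have := xk (Num.truncn (x^-1 * (L * q))); apply/negP; rewrite -ltNge.
rewrite -ltr_pdivrMl //; apply: lt_trans (truncnS_gt _) _.
by rewrite -natrX ltr_nat ltn_expl.
Qed.

(** Variational inequality at a minimizer of [F] over [S], where [F] is a
    convex function [f] plus a part whose variation along the segment from [u]
    to [v] is at most [t * l + t ^+ 2 * c]. *)
Lemma argmin_variational S f (F : 'cV[R]_n -> R) u v (l c : R) :
  convex_set S -> below_chords S f -> is_argmin S F u -> S v ->
  (forall t, F (u + t *: (v - u)) - F u <=
     f (u + t *: (v - u)) - f u + t * l + t ^+ 2 * c) ->
  0 <= f v - f u + l.
Proof.
move=> cS cf [Su Fmin] Sv Ft; apply/ler_addgt0Pr => e e0.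
have c0 : 0 < `|c| + 1 by rewrite ltr_wpDl.
pose t := Num.min 1 (e / (`|c| + 1)).
have t0 : 0 < t by rewrite lt_min ltr01 /= divr_gt0.
have t1 : 0 <= t <= 1 by rewrite ltW //= ge_min lexx.
have te : t * c <= e.
  have : t <= e / (`|c| + 1) by rewrite ge_min lexx orbT.
  rewrite ler_pdivlMr // => te; apply: le_trans te; rewrite ler_pM2l //.
  by apply: le_trans (ler_norm c) _; rewrite lerDl.
have := Fmin _ (convex_segment cS Su Sv t1); have := Ft t.
have := cf _ _ _ Su Sv t1.
have : t * (t * c) <= t * e by rewrite ler_pM2l.
move=> tce ch Fu Fm; rewrite -(ler_pM2l t0); lra.
Qed.

(** Lower semicontinuity of [f] along [S], in epsilon-delta form for the
    Euclidean norm. *)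
Definition eps_lsc S f : Prop := forall u (e : R), S u -> 0 < e ->
  exists2 d : R, 0 < d & forall v, enorm (v - u) < d -> S v -> f u - e < f v.

Lemma lsc_on_eps S f : lsc_on S f -> eps_lsc S f.
Proof.
move=> lf u e Su e0.
have /lf[V] : ((f u - e)%:E < (f u)%:E)%E by rewrite lte_fin gtrBl.
move=> /(nbhs_subspace_ex _ Su)[W /nbhs_enormP[d d0 dW] WV] Vf.
exists d => // v vd Sv; rewrite -lte_fin; apply: Vf.
by have [] : (V `&` S) v by rewrite WV; split=> //; exact: dW.
Qed.

Lemma eps_lscD S f1 f2 :
  eps_lsc S f1 -> eps_lsc S f2 -> eps_lsc S (fun u => f1 u + f2 u).
Proof.
move=> l1 l2 u e Su e0; have e20 : 0 < e / 2 by rewrite divr_gt0.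
have [d1 d10 h1] := l1 u _ Su e20; have [d2 d20 h2] := l2 u _ Su e20.
exists (Num.min d1 d2); first by rewrite lt_min d10.
move=> v; rewrite lt_min => /andP[/h1 + /h2 + Sv].
by move=> /(_ Sv) + /(_ Sv); lra.
Qed.

Lemma eps_lscS S S' f : S' `<=` S -> eps_lsc S f -> eps_lsc S' f.
Proof.
move=> SS lf u e /SS Su /(lf _ _ Su)[d d0 h].
by exists d => // v /h vd /SS.
Qed.

Lemma convex_differentiable_eps_lsc S f :
  convex_set S -> below_chords S f -> differentiable_on S f -> eps_lsc S f.
Proof.
move=> cS cf df u e Su e0; have [g fg] := df u Su.
have g0 : 0 < enorm g + 1 by rewrite ltr_wpDl ?enorm_ge0.
exists (e / (enorm g + 1)) => [|v]; first exact: divr_gt0.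
rewrite ltr_pdivlMr // => vu Sv.
have := below_chords_gradient cS cf fg Su Sv.
have := dotp_abs g (v - u); rewrite ler_norml => /andP[+ _].
by have := enorm_ge0 (v - u); lra.
Qed.

(** Were the minimum not attained, every [f u] would exceed a smaller value
    of [f] on [K], uniformly near [u]; covering [K] by these neighbourhoods
    yields a value of [f] on [K] below all its values. *)
Lemma compact_eps_lsc_argmin K f : compact K -> K !=set0 -> eps_lsc K f ->
  exists u, is_argmin K f u.
Proof.
move=> /compact_near_coveringP cK [w0 Kw0] lf; apply: contrapT => nomin.
have lower u : K u -> exists2 w, K w & f w < f u.
  move=> Ku; apply: contrapT => nw; apply: nomin; exists u; split=> // v Kv.
  by rewrite leNgt; apply/negP => fv; apply: nw; exists v.
(* [F] is generated by the half-lines below the values of [f] on [K]. *)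
pose F : set_system R := [set B | exists2 w, K w & forall r, r <= f w -> B r].
have FF : Filter F.
  split; first by exists w0.
  - move=> B C [w Kw wB] [w' Kw' wC].
    have [ww|/ltW ww] := leP (f w) (f w').
      by exists w => // r rw; split; [exact: wB|apply: wC; exact: le_trans ww].
    by exists w' => // r rw; split; [apply: wB; exact: le_trans ww|exact: wC].
  - by move=> B C BC [w Kw wB]; exists w => // r /wB /BC.
have [w Kw wmin] : F (fun r => K `<=` [set u | K u -> r < f u]).
  apply: (cK _ F (fun r u => K u -> r < f u)) => u Ku.
  have [w Kw wu] := lower u Ku.
  have [|d d0 dP] := lf u (f u - f w) Ku; first by rewrite subr_gt0.
  exists ([set v | enorm (v - u) < d], [set r | r <= f w]) => /=.
    by split; [apply/nbhs_enormP; exists d|exists w].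
  move=> [v r] /= [vd rw] Kv; apply: le_lt_trans rw _.
  by rewrite -(subKr (f u) (f w)) dP.
by have := wmin (f w) (lexx _) w Kw Kw; rewrite /= ltxx.
Qed.

End Convex_analysis.

(** * Ergodic means *)

Section Ergodic.
Set Implicit Arguments.
Unset Strict Implicit.
Context {R : realType} {n : nat}.
Implicit Types (u : nat -> 'cV[R]_n) (S : set 'cV[R]_n).

Lemma ergodic_meanS u T : ergodic_mean T.+2 u =
  ergodic_mean T.+1 u + T.+2%:R^-1 *: (u T.+2 - ergodic_mean T.+1 u).
Proof.
rewrite /ergodic_mean big_nat_recr //=; set s := \sum_(_ <= _ < _) _.
set a := T.+1%:R^-1; set b := T.+2%:R^-1.
have bE : b = a - b * a.
  have := ltr0Sn R T; rewrite /a /b -(natr1 T.+1); move: T.+1%:R => p p0.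
  by field; rewrite !gt_eqF ?addr_gt0.
by rewrite scalerDr {1}bE scalerBl scalerBr scalerA -addrA [- _ + _]addrC.
Qed.

(** Jensen's inequality. *)
Lemma ergodic_mean_jensen S f u T :
  convex_set S -> below_chords S f -> (forall k, S (u k.+1)) ->
  S (ergodic_mean T.+1 u) /\
  T.+1%:R * f (ergodic_mean T.+1 u) <= \sum_(1 <= k < T.+2) f (u k).
Proof.
move=> cS cf Su; elim: T => [|T [Sm Hm]].
  by rewrite /ergodic_mean !big_nat1 invr1 scale1r mul1r.
have t01 : 0 <= (T.+2%:R^-1 : R) <= 1.
  by rewrite invr_ge0 ler0n invf_le1 ?ltr0n // ler1n.
rewrite ergodic_meanS; split; first exact: convex_segment.
rewrite big_nat_recr //=; apply: le_trans (lerD Hm (lexx _)).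
have := cf _ _ _ Sm (Su T.+1) t01; rewrite -(ler_pM2l (ltr0Sn R T.+1)).
move=> /le_trans; apply; rewrite le_eqVlt; apply/orP; left; apply/eqP.
have := ltr0Sn R T; rewrite -(natr1 T.+1); move: T.+1%:R => p p0.
by field; rewrite gt_eqF ?addr_gt0.
Qed.

Lemma ergodic_mean_in S u T :
  convex_set S -> (forall k, S (u k.+1)) -> S (ergodic_mean T.+1 u).
Proof.
move=> cS Su.
have c0 : below_chords S (fun=> 0) by move=> *; rewrite subrr mulr0 addr0.
by have [] := ergodic_mean_jensen T cS c0 Su.
Qed.

End Ergodic.

(** * The SEG-ADMM iteration *)

Section Seg_admm.
Set Implicit Arguments.
Unset Strict Implicit.
Context {R : realType} {d1 d2 d n : nat}.
Variables (P : problem R d1 d2 d n) (Lx Ly gamma : R).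
Variables (H1 : 'M[R]_d1) (H2 : 'M[R]_d2) (G : 'M[R]_d).
Hypothesis sets : constraint_sets P.
Hypothesis conv : convexity_assumption P Lx.
Hypothesis lips : lipschitz_assumption P Ly.
Hypothesis gamma_gt0 : 0 < gamma.
Hypotheses (posH1 : posdefmx H1) (posH2 : posdefmx H2) (posG : posdefmx G).
Hypothesis leH1 : loewner_le (Lx + Ly)%:M H1.
Hypothesis leH2 : loewner_le (Lx + Ly)%:M H2.
Hypothesis leG : loewner_le Ly%:M G.

Notation X := (X P).
Notation Y := (Y P).
Notation A := (A P).

(** ** Structure of the problem *)

Lemma X_convex : convex_set X.
Proof.
move=> u v t; rewrite !inE => -[u1 u2] [v1 v2].
have [[_ c1] [_ c2] _] := sets.
split.
- have := c1 (usubmx u) (usubmx v) t; rewrite !inE => /(_ u1 v1).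
  by congr (X1 P _); rewrite /conv /= linearD !linearZ.
- have := c2 (dsubmx u) (dsubmx v) t; rewrite !inE => /(_ u2 v2).
  by congr (X2 P _); rewrite /conv /= linearD !linearZ.
Qed.

Lemma Y_convex : convex_set Y.
Proof. by case: sets => _ _ []. Qed.

Lemma X_compact : compact X.
Proof.
have [[k1 _] [k2 _] _] := sets.
have -> : X = (fun p => col_mx p.1 p.2) @` (X1 P `*` X2 P).
  apply/seteqP; split=> [u [u1 u2]|_ [[a b] [/= a1 b2] <-]].
    by exists (usubmx u, dsubmx u) => //=; rewrite vsubmxK.
  by split; rewrite ?col_mxKu ?col_mxKd.
apply: continuous_compact; last exact: compact_setX.
apply: continuous_subspaceT => -[a b] V /nbhs_enormP[/= e e0 eV].
exists ([set v | enorm (v - a) < e / 2], [set v | enorm (v - b) < e / 2]) => /=.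
  by split; apply/nbhs_enormP; exists (e / 2); rewrite ?divr_gt0.
move=> [a' b'] /= [ha hb]; apply: eV => /=.
rewrite opp_col_mx add_col_mx.
have -> : col_mx (a' - a) (b' - b) = col_mx (a' - a) 0 + col_mx 0 (b' - b).
  by rewrite add_col_mx addr0 add0r.
apply: le_lt_trans (enorm_triangle _ _) _.
by rewrite {1 2}/enorm !dotp_col_mx !dotp0 addr0 add0r (splitr e) ltrD.
Qed.

Lemma feasible_compact : compact (feasible P).
Proof.
have -> : feasible P = X `&` [set x | A *m x = rhs P].
  by apply/seteqP; split.
apply: compact_closedI X_compact _ => p clp /=.
have [c c0 Ac] := enorm_mulmx_bounded A.
apply/eqP; rewrite -subr_eq0; apply/eqP/enorm_eq0/eqP.
rewrite eq_le enorm_ge0 andbT; apply/ler_addgt0Pr => e e0; rewrite add0r.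
have [|q [/= <- qp]] := clp [set v | enorm (v - p) < e / (c + 1)].
  by apply/nbhs_enormP; exists (e / (c + 1)) => //; rewrite divr_gt0 ?ltr_wpDl.
rewrite -mulmxBr; apply: le_trans (Ac _) _; rewrite enorm_distC.
move: qp; rewrite ltr_pdivlMr ?ltr_wpDl //.
have := enorm_ge0 (q - p); lra.
Qed.

Lemma hsum_below_chords y : Y y -> below_chords X (fun x => hsum P x y).
Proof.
move=> Yy; have [_ /(_ y Yy)[c1 _ c2 _] _ _ _] := conv.
move=> u v t [u1 u2] [v1 v2] t01; rewrite /hsum.
have := convex_below_chords c1 u1 v1 t01.
have := convex_below_chords c2 u2 v2 t01.
rewrite -!linearB -!linearZ -!linearD /=; lra.
Qed.

Lemma Psi_below_chords y : Y y -> below_chords X (fun x => Psi P x y).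
Proof.
by move=> Yy; case: conv => _ _ _ /(_ y Yy)[_ /convex_below_chords].
Qed.

Lemma Phi_below_chords y : Y y -> below_chords X (fun x => Phi P x y).
Proof.
move=> Yy; apply: below_chordsD; first exact: hsum_below_chords.
exact: Psi_below_chords.
Qed.

Lemma Phi_concave x : X x -> below_chords Y (fun y => - Phi P x y).
Proof. by move=> Xx; case: conv => /(_ x Xx)[/convex_below_chords]. Qed.

Lemma gradx_PsiP x y : X x -> Y y -> is_gradient X (Psi P ^~ y) x (gradx_Psi P x y).
Proof.
move=> Xx Yy; case: conv => _ _ _ /(_ y Yy)[/(_ x Xx) + _] _.
by move=> [g gP]; exact: (xgetPex 0 (ex_intro _ g gP)).
Qed.

Lemma grady_PhiP x y : X x -> Y y -> is_gradient Y (Phi P x) y (grady_Phi P x y).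
Proof.
move=> Xx Yy; case: lips => /(_ x Xx y Yy) + _.
by move=> [g gP]; exact: (xgetPex 0 (ex_intro _ g gP)).
Qed.

Lemma Psi_descent x x' y : X x -> X x' -> Y y ->
  Psi P x' y <= Psi P x y + dotp (gradx_Psi P x y) (x' - x)
                + Lx / 2 * dotp (x' - x) (x' - x).
Proof.
move=> Xx Xx' Yy; have [_ _ _ _ gL] := conv.
apply: (descent_lemma X_convex (Psi_below_chords Yy)) => // [w Xw|w w' Xw Xw'].
  exact: gradx_PsiP.
exact: gL.
Qed.

Lemma Psi_gradient_le x x' y : X x -> X x' -> Y y ->
  Psi P x y + dotp (gradx_Psi P x y) (x' - x) <= Psi P x' y.
Proof.
move=> Xx Xx' Yy.
exact: (below_chords_gradient X_convex (Psi_below_chords Yy) (gradx_PsiP Xx Yy)).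
Qed.

Lemma Phi_gradient_ge x y y' : X x -> Y y -> Y y' ->
  Phi P x y' <= Phi P x y + dotp (grady_Phi P x y) (y' - y).
Proof.
move=> Xx Yy Yy'; rewrite -lerN2 opprD -dotpNl.
apply: (below_chords_gradient Y_convex (Phi_concave Xx)) => // e e0.
near=> v; have : `|Phi P x v - Phi P x y - dotp (grady_Phi P x y) (v - y)|
    <= e * enorm (v - y) by near: v; exact: (grady_PhiP Xx Yy).
by rewrite dotpNl -normrN !opprD.
Unshelve. all: by end_near. Qed.

Lemma max_Phi_exists x y0 : X x -> Y y0 ->
  exists2 y, Y y & max_Phi P x (Phi P x y).
Proof.
move=> Xx Yy0; have [_ _ [kY _]] := sets.
have [/(_ x Xx)[_ ux] _ _ _ _] := conv.
have [y [Yy ymin]] :=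
  compact_eps_lsc_argmin kY (ex_intro _ y0 Yy0) (lsc_on_eps ux).
exists y => //; split; first by exists y.
by move=> _ [v /ymin + <-]; rewrite lerN2.
Qed.

Lemma min_Phi_exists x0 y : feasible P x0 -> Y y ->
  exists2 x, feasible P x & min_Phi P y (Phi P x y).
Proof.
move=> Fx0 Yy; have [_ /(_ y Yy)[_ l1 _ l2] _ /(_ y Yy)[dPsi _] _] := conv.
have lPsi : eps_lsc X (fun x => Psi P x y).
  exact: convex_differentiable_eps_lsc X_convex (Psi_below_chords Yy) dPsi.
have lh1 : eps_lsc X (fun x => h1 P (usubmx x) y).
  move=> u e [u1 _] e0; have [dl dl0 h] := lsc_on_eps l1 u1 e0.
  exists dl => // v vu [v1 _]; apply: h => //; apply: le_lt_trans vu.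
  rewrite -linearB -[in leRHS](vsubmxK (v - u)) /enorm dotp_col_mx ler_wsqrtr //.
  by rewrite lerDl dotp_ge0.
have lh2 : eps_lsc X (fun x => h2 P (dsubmx x) y).
  move=> u e [_ u2] e0; have [dl dl0 h] := lsc_on_eps l2 u2 e0.
  exists dl => // v vu [_ v2]; apply: h => //; apply: le_lt_trans vu.
  rewrite -linearB -[in leRHS](vsubmxK (v - u)) /enorm dotp_col_mx ler_wsqrtr //.
  by rewrite lerDr dotp_ge0.
have lPhi : eps_lsc (feasible P) (fun x => Phi P x y).
  apply: (@eps_lscS _ _ X) => [u []//|].
  exact: eps_lscD (eps_lscD lh1 lh2) lPsi.
have [x [Fx xmin]] :=
  compact_eps_lsc_argmin feasible_compact (ex_intro _ x0 Fx0) lPhi.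
exists x => //; split; first by exists x.
by move=> _ [v /xmin + <-].
Qed.

(** Exact penalization: under Slater's condition the optimal value exceeds the
    value at any point of [X] by at most a multiple of the residual there.  A
    point [u] of [X] with residual [r] is moved towards an interior feasible
    point [xh], perturbed inside [X] so as to cancel [r]; the step needed is at
    most proportional to [enorm r], and [Phi] is convex and bounded along it. *)
Lemma slater_penalty : slater P -> exists2 c : R, 0 <= c &
  forall u y m, X u -> Y y -> min_Phi P y m ->
    m <= Phi P u y + c * enorm (residual P u).
Proof.
move=> [xh [_ [/nbhs_enormP[dl dl0 dlX] _ Axh]]].
have [_ _ [B PhiB] _ _] := conv.
have [kap kap0 kapP] := enorm_mulmx_bounded (pinvmx A).
exists (4 * `|B| * (kap + 1) / dl) => [|u y m Xu Yy [_ mle]].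
  by rewrite divr_ge0 ?mulr_ge0 ?addr_ge0 ?(ltW dl0).
set r := residual P u.
pose v := - (pinvmx A *m r).
have Av : A *m v = - r.
  have -> : v = - (pinvmx A *m (A *m (u - xh))) by rewrite mulmxBr Axh.
  rewrite mulmxN (mulmxA A (pinvmx A)) (mulmxA _ A) (mulmxKpV (submx_refl A)).
  by rewrite mulmxBr Axh.
have [r0|r0] := eqVneq (enorm r) 0.
  rewrite r0 mulr0 addr0; apply: mle; exists u => //; split=> //.
  by apply/eqP; rewrite -subr_eq0; apply/eqP/enorm_eq0.
pose s := (kap + 1) * enorm r.
have s0 : 0 < s by rewrite mulr_gt0 ?ltr_wpDl // lt_neqAle eq_sym r0 enorm_ge0.
have sdl0 : 0 < s + dl / 2 by rewrite addr_gt0 ?divr_gt0.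
(* [t * (dl / 2 / s) = 1 - t], so the part [w] of the step cancels the residual
   left by the convex combination. *)
pose w := (dl / 2 / s) *: v; pose t := s / (s + dl / 2).
have t0 : 0 <= t by rewrite divr_ge0 ?ltW.
have t01 : 0 <= t <= 1 by rewrite t0 ler_pdivrMr // mul1r lerDl divr_ge0 ?ltW.
have Xp : X (xh + w).
  apply: dlX; rewrite addrAC subrr add0r enormZ ger0_norm ?divr_ge0 ?ltW //.
  apply: (@le_lt_trans _ _ (dl / 2)); last lra.
  rewrite mulrAC ler_pdivrMr // ler_wpM2l ?divr_ge0 ?(ltW dl0) //.
  rewrite enormN; apply: le_trans (kapP r) _.
  by rewrite /s ler_wpM2r ?enorm_ge0 // lerDl.
have Fx : feasible P (u + t *: (xh + w - u)).
  split; first exact: convex_segment X_convex Xu Xp t01.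
  apply/eqP; rewrite -subr_eq0 mulmxDr -scalemxAr mulmxBr mulmxDr Axh.
  have -> : A *m w = - (dl / 2 / s) *: r by rewrite -scalemxAr Av scalerN scaleNr.
  have -> : A *m u = r + rhs P by rewrite /r /residual subrK.
  apply/eqP/matrixP => i j; rewrite !mxE /t; field.
  by rewrite !gt_eqF // addr_gt0 // mulr_gt0.
apply: le_trans (mle _ _) _; first by exists (u + t *: (xh + w - u)).
apply: le_trans (Phi_below_chords Yy Xu Xp t01) _; rewrite lerD2l.
have B0 := ler_norm B.
have Bd : Phi P (xh + w) y - Phi P u y <= 2 * `|B|.
  have := PhiB _ _ Xp Yy; have := PhiB _ _ Xu Yy.
  by rewrite !ler_norml => /andP[? ?] /andP[? ?]; lra.
apply: le_trans (ler_wpM2l t0 Bd) _.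
apply: (@le_trans _ _ (s / (dl / 2) * (2 * `|B|))).
  rewrite ler_wpM2r ?mulr_ge0 // ler_wpM2l ?(ltW s0) // lef_pV2 ?posrE ?divr_gt0 //.
  by rewrite lerDr ltW.
rewrite le_eqVlt; apply/orP; left; apply/eqP; rewrite /s; field.
exact: lt0r_neq0.
Qed.

(** ** The extragradient step *)

(** The sign of [Ly] is not assumed: if [Ly < 0], the Lipschitz assumption forces
    any two points of [X] and any two points of [Y] to coincide, and both sides
    vanish. *)
Lemma grady_Phi_cross x x' y y' w w' :
  X x -> X x' -> Y y -> Y y' -> Y w -> Y w' ->
  dotp (grady_Phi P x y - grady_Phi P x' y') (w - w') <=
  Ly / 2 * (dotp (x - x') (x - x') + dotp (y - y') (y - y')
            + dotp (w - w') (w - w')).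
Proof.
move=> Xx Xx' Yy Yy' Yw Yw'; have [_ gL] := lips.
have := gL x x' y y' Xx Xx' Yy Yy'; have := gL x x w w' Xx Xx Yw Yw'.
rewrite !subrr enorm0 expr0n add0r sqrtr_sqr ger0_norm ?enorm_ge0 //.
set s := Num.sqrt _ => gw gs.
apply: le_trans (cauchy_schwarz _ _) _; rewrite -!enorm_sqr.
have sE : enorm (x - x') ^+ 2 + enorm (y - y') ^+ 2 = s ^+ 2.
  by rewrite [RHS]sqr_sqrtr // addr_ge0 ?sqr_ge0.
rewrite sE; have s0 : 0 <= s by exact: sqrtr_ge0.
have w0 := enorm_ge0 (w - w').
have [L0|L0] := leP 0 Ly.
  apply: le_trans (ler_wpM2r w0 gs) _.
  exact: mulr_young.
have sz : s = 0.
  by apply/eqP; rewrite eq_le s0 andbT -(nmulr_rge0 _ L0) (le_trans _ gs) ?enorm_ge0.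
have wz : enorm (w - w') = 0.
  by apply/eqP; rewrite eq_le w0 andbT -(nmulr_rge0 _ L0) (le_trans _ gw) ?enorm_ge0.
by rewrite sz wz expr0n addr0 !(mul0r, mulr0).
Qed.

(** Variational inequality of the [G]-metric projection, in which the inverse of
    [G] has cancelled. *)
Lemma ascent_step_variational y g w v : ascent_step P G y g w -> Y v ->
  0 <= dotp (G *m (w - y)) (v - w) - dotp g (v - w).
Proof.
move=> wP Yv; set l := (_ - _ : R).
suff : 0 <= 0 - 0 + l by rewrite subrr add0r.
apply: (argmin_variational (f := fun=> 0) (c := 2^-1 * qnorm2 G (v - w))
  Y_convex _ wP Yv) => [? ? ? _ _ _|t]; first by rewrite subrr mulr0 addr0.
have -> : w + t *: (v - w) - (y + invmx G *m g)
        = (w - (y + invmx G *m g)) + t *: (v - w) by rewrite addrAC.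
rewrite (qnorm2D _ _ posG.1) qnorm2Z dotpZr opprD addrA mulmxBr mulKVmx.
  by rewrite dotpDl dotpNl /l; lra.
exact: posdef_unitmx.
Qed.

(** The error term, the variation of the gradient against [y' - yh], is absorbed
    by the negative squares in the metric [G], up to the part in [x' - x]. *)
Lemma extragradient_step x x' y yh y' ys :
  X x -> X x' -> Y y -> Y ys ->
  ascent_step P G y (grady_Phi P x y) yh ->
  ascent_step P G y (grady_Phi P x' yh) y' ->
  Phi P x' ys - Phi P x' yh <=
    (qnorm2 G (ys - y) - qnorm2 G (ys - y')) / 2
    + Ly / 2 * dotp (x' - x) (x' - x).
Proof.
move=> Xx Xx' Yy Yys yhP y'P; have [Yyh _] := yhP; have [Yy' _] := y'P.
have c1 := ascent_step_variational yhP Yy'.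
have c2 := ascent_step_variational y'P Yys.
have c3 := Phi_gradient_ge Xx' Yyh Yys.
have c4 := grady_Phi_cross Xx' Xx Yyh Yy Yy' Yyh.
move: c1 c2; rewrite !dotp_three_point ?posG.1 // => c1 c2.
have c5 := possemidef_loewner (yh - y) leG.
have c6 := possemidef_loewner (y' - yh) leG.
have c7 : dotp (grady_Phi P x' yh) (ys - yh) =
    dotp (grady_Phi P x' yh) (ys - y') + dotp (grady_Phi P x' yh) (y' - yh).
  by rewrite -dotpDr addrA subrK.
move: c4; rewrite dotpDl dotpNl; lra.
Qed.

(** ** The proximal ADMM step *)

(** Besides [hsum], the linearized augmented Lagrangian is quadratic along
    segments. *)
Lemma lin_aug_lagrangian_segment z D lam xt yt (t : R) :
  lin_aug_lagrangian P gamma (z + t *: D) lam xt yt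
  - lin_aug_lagrangian P gamma z lam xt yt =
  hsum P (z + t *: D) yt - hsum P z yt
  + t * (dotp (gradx_Psi P xt yt) D - dotp lam (A *m D)
         + gamma * dotp (residual P z) (A *m D))
  + t ^+ 2 * (gamma / 2 * dotp (A *m D) (A *m D)).
Proof.
rewrite /lin_aug_lagrangian.
have -> : residual P (z + t *: D) = residual P z + t *: (A *m D).
  by rewrite /residual mulmxDr -scalemxAr addrAC.
rewrite (addrAC z) !enorm_sqr.
rewrite [dotp (residual P z + _) _]dotpDl [dotp _ (residual P z + _)]dotpDr.
rewrite !(dotpDr _ (t *: _)) !(dotpZl, dotpZr) (dotpC (A *m D) (residual _ _)).
by field.
Qed.

Lemma prox_block1_variational x lam y u w :
  X x -> Y y -> X1 P w ->
  is_argmin (X1 P)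
    (fun w => lin_aug_lagrangian P gamma (col_mx w (dsubmx x)) lam x y
              + 2^-1 * qnorm2 H1 (w - usubmx x)) u ->
  forall D, D = col_mx (w - u) 0 ->
  0 <= h1 P w y - h1 P u y
    + (dotp (gradx_Psi P x y) D - dotp lam (A *m D)
       + gamma * dotp (residual P (col_mx u (dsubmx x))) (A *m D)
       + dotp (H1 *m (u - usubmx x)) (w - u)).
Proof.
move=> Xx Yy Xw uP D DE.
have [[_ c1] _ _] := sets; have [_ /(_ y Yy)[f1 _ _ _] _ _ _] := conv.
pose c := gamma / 2 * dotp (A *m D) (A *m D) + 2^-1 * qnorm2 H1 (w - u).
apply: (argmin_variational (f := h1 P ^~ y) (c := c) c1
  (convex_below_chords f1) uP Xw) => t.
have DtE : col_mx (u + t *: (w - u)) (dsubmx x) = col_mx u (dsubmx x) + t *: D.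
  by rewrite DE scale_col_mx scaler0 add_col_mx addr0.
have := lin_aug_lagrangian_segment (col_mx u (dsubmx x)) D lam x y t.
rewrite -DtE /= {1 2}/hsum !(col_mxKu, col_mxKd) (addrAC u).
rewrite (qnorm2D (u - usubmx x) (t *: (w - u)) posH1.1) qnorm2Z dotpZr /c; lra.
Qed.

Lemma prox_block2_variational x lam y u1 u w :
  X x -> Y y -> X2 P w ->
  is_argmin (X2 P)
    (fun w => lin_aug_lagrangian P gamma (col_mx u1 w) lam x y
              + 2^-1 * qnorm2 H2 (w - dsubmx x)) u ->
  forall D, D = col_mx 0 (w - u) ->
  0 <= h2 P w y - h2 P u y
    + (dotp (gradx_Psi P x y) D - dotp lam (A *m D)
       + gamma * dotp (residual P (col_mx u1 u)) (A *m D)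
       + dotp (H2 *m (u - dsubmx x)) (w - u)).
Proof.
move=> Xx Yy Xw uP D DE.
have [_ [_ c2] _] := sets; have [_ /(_ y Yy)[_ _ f2 _] _ _ _] := conv.
pose c := gamma / 2 * dotp (A *m D) (A *m D) + 2^-1 * qnorm2 H2 (w - u).
apply: (argmin_variational (f := h2 P ^~ y) (c := c) c2
  (convex_below_chords f2) uP Xw) => t.
have DtE : col_mx u1 (u + t *: (w - u)) = col_mx u1 u + t *: D.
  by rewrite DE scale_col_mx scaler0 add_col_mx addr0.
have := lin_aug_lagrangian_segment (col_mx u1 u) D lam x y t.
rewrite -DtE /= {1 2}/hsum !(col_mxKu, col_mxKd) (addrAC u).
rewrite (qnorm2D (u - dsubmx x) (t *: (w - u)) posH2.1) qnorm2Z dotpZr /c; lra.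
Qed.


Lemma prox_admm_step x lam y x' lam' xs ls :
  X x -> Y y -> feasible P xs ->
  prox_admm P gamma H1 H2 x lam y x' lam' ->
  hsum P x' y - hsum P xs y + dotp (gradx_Psi P x y) (x' - xs)
    - dotp ls (residual P x') <=
  (dotp (lam - ls) (lam - ls) - dotp (lam' - ls) (lam' - ls)) / (2 * gamma)
  + gamma / 2 * (enorm (A2 P *m (dsubmx xs - dsubmx x)) ^+ 2
                 - enorm (A2 P *m (dsubmx xs - dsubmx x')) ^+ 2)
  + (qnorm2 H1 (usubmx xs - usubmx x) - qnorm2 H1 (usubmx xs - usubmx x')
     - qnorm2 H1 (usubmx x' - usubmx x)) / 2
  + (qnorm2 H2 (dsubmx xs - dsubmx x) - qnorm2 H2 (dsubmx xs - dsubmx x')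
     - qnorm2 H2 (dsubmx x' - dsubmx x)) / 2.
Proof.
move=> Xx Yy [[xs1 xs2] Axs] [P1 P2 ->].
have := prox_block1_variational Xx Yy xs1 P1 erefl.
have := prox_block2_variational Xx Yy xs2 P2 erefl.
rewrite vsubmxK !dotp_three_point ?posH1.1 ?posH2.1 //.
set D1 := col_mx _ 0; set D2 := col_mx 0 _; set r := residual P x'.
set r1 := residual P (col_mx _ _).
(* The first block is optimal for the old second block, hence for the residual
   [r1 = r - p]. *)
pose p := A2 P *m (dsubmx x' - dsubmx x).
pose s := A2 P *m (dsubmx xs - dsubmx x').
have D12 : x' - xs = - (D1 + D2).
  by rewrite add_col_mx addr0 add0r -!linearB vsubmxK opprB.
have AD2 : A *m D2 = s by rewrite mul_row_col mulmx0 add0r.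
have AD1 : A *m D1 = - r - s.
  have -> : D1 = - (x' - xs) - D2 by rewrite D12 opprK addrK.
  by rewrite mulmxBr AD2 mulmxN mulmxBr Axs.
have r1E : r1 = r - p.
  rewrite /r1 /r /p /residual -{2}(vsubmxK x') !mul_row_col mulmxBr.
  move: (A1 P *m _) (A2 P *m dsubmx x') (A2 P *m _) => a b c.
  by apply/matrixP => i j; rewrite !mxE; ring.
have -> : A2 P *m (dsubmx xs - dsubmx x) = p + s.
  by rewrite -mulmxDr [in RHS]addrC addrA subrK.
rewrite !enorm_sqr D12 AD1 AD2 r1E.
have -> : lam - gamma *: r - ls = (lam - ls) - gamma *: r by rewrite addrAC.
have -> : (dotp (lam - ls) (lam - ls)
    - dotp (lam - ls - gamma *: r) (lam - ls - gamma *: r)) / (2 * gamma)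
    = dotp (lam - ls) r - gamma / 2 * dotp r r.
  rewrite !(dotpDl _ (- (_ *: _))) !(dotpDr _ (- (_ *: _))) !dotpNl !dotpNr.
  rewrite !dotpZl !dotpZr (dotpC r); field; exact: lt0r_neq0.
have := ler_wpM2l (ltW gamma_gt0) (dotp_young p r).
rewrite !dotpE (dotpC s p); rewrite /hsum.
lra.
Qed.

(** Lyapunov function of the method relative to a comparison point
    [(xs, ys, ls)]: it decreases by at least the primal-dual gap. *)
Definition potential xs (ys : 'cV[R]_d) (ls : 'cV[R]_n) x (y : 'cV[R]_d)
    (lam : 'cV[R]_n) : R :=
  dotp (lam - ls) (lam - ls) / (2 * gamma)
  + gamma / 2 * enorm (A2 P *m (dsubmx xs - dsubmx x)) ^+ 2
  + (qnorm2 H1 (usubmx xs - usubmx x) + qnorm2 H2 (dsubmx xs - dsubmx x)) / 2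
  + qnorm2 G (ys - y) / 2.

Lemma potential_ge0 xs ys ls x y lam : 0 <= potential xs ys ls x y lam.
Proof.
have q1 := posdef_qnorm2_ge0 (usubmx xs - usubmx x) posH1.
have q2 := posdef_qnorm2_ge0 (dsubmx xs - dsubmx x) posH2.
have qG := posdef_qnorm2_ge0 (ys - y) posG.
have qA : 0 <= gamma / 2 * enorm (A2 P *m (dsubmx xs - dsubmx x)) ^+ 2.
  by rewrite mulr_ge0 ?sqr_ge0 ?divr_ge0 ?ltW.
have ql : 0 <= dotp (lam - ls) (lam - ls) / (2 * gamma).
  by rewrite divr_ge0 ?dotp_ge0 ?mulr_ge0 ?ltW.
rewrite /potential; lra.
Qed.

Lemma potential_step x lam y x' lam' y' yh xs ys ls :
  X x -> X x' -> Y y -> Y ys -> feasible P xs ->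
  ascent_step P G y (grady_Phi P x y) yh ->
  prox_admm P gamma H1 H2 x lam yh x' lam' ->
  ascent_step P G y (grady_Phi P x' yh) y' ->
  Phi P x' ys - dotp ls (residual P x') - Phi P xs yh <=
  potential xs ys ls x y lam - potential xs ys ls x' y' lam'.
Proof.
move=> Xx Xx' Yy Yys Fxs yhP xP y'P; have [Yyh _] := yhP; have [Xxs _] := Fxs.
have := extragradient_step Xx Xx' Yy Yys yhP y'P.
have := prox_admm_step ls Xx Yyh Fxs xP.
have := Psi_descent Xx Xx' Yyh; have := Psi_gradient_le Xx Xxs Yyh.
have := possemidef_loewner (usubmx x' - usubmx x) leH1.
have := possemidef_loewner (dsubmx x' - dsubmx x) leH2.
have -> : dotp (x' - x) (x' - x) =
    dotp (usubmx x' - usubmx x) (usubmx x' - usubmx x)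
    + dotp (dsubmx x' - dsubmx x) (dsubmx x' - dsubmx x).
  by rewrite -!linearB -dotp_col_mx vsubmxK.
have -> : dotp (gradx_Psi P x yh) (x' - xs) =
    dotp (gradx_Psi P x yh) (x' - x) - dotp (gradx_Psi P x yh) (xs - x).
  by rewrite -dotpNr -dotpDr opprB addrA subrK.
rewrite /potential /Phi; lra.
Qed.

Section Run.
Context (x : nat -> 'cV[R]_(d1 + d2)) (y yh : nat -> 'cV[R]_d)
  (lam : nat -> 'cV[R]_n).
Hypothesis run : seg_admm P gamma H1 H2 G x y yh lam.

Lemma run_X k : X (x k).
Proof. by case: run => + _ _; case: k => // k _ /(_ k)[_ [[? _] [? _] _] _]. Qed.

Lemma run_Y k : Y (y k).
Proof. by case: run => _ + _; case: k => // k _ /(_ k)[_ _ []]. Qed.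

Lemma run_Yh k : Y (yh k.+1).
Proof. by case: run => _ _ _ /(_ k)[[]]. Qed.

Lemma potential_telescope xs ys ls T : feasible P xs -> Y ys ->
  \sum_(1 <= k < T.+1) (Phi P (x k) ys - dotp ls (residual P (x k)))
  + \sum_(1 <= k < T.+1) - Phi P xs (yh k) <=
  potential xs ys ls (x 0%N) (y 0%N) (lam 0%N)
  - potential xs ys ls (x T) (y T) (lam T).
Proof.
move=> Fxs Yys; elim: T => [|T IH]; first by rewrite !big_geq // addr0 subrr.
rewrite !(big_nat_recr T.+1) //=; have [_ _ _ /(_ T)[yhP xP yP]] := run.
have := potential_step ls (run_X T) (run_X T.+1) (run_Y T) Yys Fxs yhP xP yP.
move: IH; lra.
Qed.

Lemma ergodic_gap xs ys ls T : feasible P xs -> Y ys ->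
  T.+1%:R * (Phi P (ergodic_mean T.+1 x) ys
             - dotp ls (residual P (ergodic_mean T.+1 x))
             - Phi P xs (ergodic_mean T.+1 yh)) <=
  potential xs ys ls (x 0%N) (y 0%N) (lam 0%N).
Proof.
move=> Fxs Yys.
have := potential_telescope ls T.+1 Fxs Yys.
have := potential_ge0 xs ys ls (x T.+1) (y T.+1) (lam T.+1).
have cF : below_chords X (fun x => Phi P x ys - dotp ls (residual P x)).
  apply: below_chordsD; first exact: Phi_below_chords.
  move=> u v t _ _ _.
  have -> : residual P (u + t *: (v - u))
      = residual P u + t *: (residual P v - residual P u).
    rewrite /residual mulmxDr -scalemxAr mulmxBr addrAC.
    by move: (A *m u) (A *m v) => a b; apply/matrixP => i j; rewrite !mxE; ring.
  by rewrite !dotpE; lra.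
have [_] := ergodic_mean_jensen T X_convex cF (fun k => run_X k.+1).
have [_] := ergodic_mean_jensen T Y_convex (Phi_concave Fxs.1) run_Yh.
lra.
Qed.

Lemma ergodic_bound T rho x0 : 0 < rho -> feasible P x0 ->
  let xbar := ergodic_mean T.+1 x in
  let ybar := ergodic_mean T.+1 yh in
  exists M m : R,
    [/\ max_Phi P xbar M, min_Phi P ybar m &
      M - m + rho * enorm (residual P xbar) <=
        (rho ^+ 2 / gamma
         + gamma * specnorm (A2 P) ^+ 2 * diameter (X2 P) ^+ 2
         + specnorm (block_mx H1 0 0 H2) * diameterX P ^+ 2
         + specnorm G * diameter Y ^+ 2) / (2 * T.+1%:R)].
Proof.
move=> rho0 Fx0 xbar ybar.
have Xb := ergodic_mean_in T X_convex (fun k => run_X k.+1).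
have Yb := ergodic_mean_in T Y_convex run_Yh.
have [ys Yys ysP] := max_Phi_exists Xb (run_Y 0).
have [xs Fxs xsP] := min_Phi_exists Fx0 Yb.
exists (Phi P xbar ys), (Phi P xs ybar); split=> //.
set r := residual P xbar.
(* The multiplier of norm [rho] opposite to the residual turns the linear term
   of the gap into the penalty. *)
pose ls := - (rho / enorm r) *: r.
have lsr : - dotp ls r = rho * enorm r.
  rewrite /ls dotpZl -enorm_sqr mulNr opprK.
  have [->|r0] := eqVneq (enorm r) 0; first by rewrite expr0n !mulr0.
  by rewrite expr2 mulrA divfK.
have lsls : dotp ls ls <= rho ^+ 2.
  rewrite /ls dotpZl dotpZr -enorm_sqr.
  have [->|r0] := eqVneq (enorm r) 0; first by rewrite expr0n !mulr0 sqr_ge0.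
  by rewrite le_eqVlt; apply/orP; left; apply/eqP; field.
have [[k1 _] [k2 _] [kY _]] := sets; have [[xs1 xs2] _] := Fxs.
have [x01 x02] := run_X 0.
have dY := diameter_ge kY Yys (run_Y 0).
have dX1 := diameter_ge k1 xs1 x01.
have dX2 := diameter_ge k2 xs2 x02.
have dX : enorm (xs - x 0%N) <= diameterX P.
  rewrite ler_wsqrtr // -(vsubmxK (xs - x 0%N)) dotp_col_mx !linearB.
  have D1 := le_trans (enorm_ge0 _) dX1; have D2 := le_trans (enorm_ge0 _) dX2.
  by rewrite -!enorm_sqr lerD // lerXn2r ?nnegrE ?enorm_ge0.
have HE : qnorm2 (block_mx H1 0 0 H2) (xs - x 0%N) =
    qnorm2 H1 (usubmx xs - usubmx (x 0%N))
    + qnorm2 H2 (dsubmx xs - dsubmx (x 0%N)).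
  rewrite -{1}(vsubmxK (xs - x 0%N)) /qnorm2 mul_block_col !mul0mx addr0 add0r.
  by rewrite dotp_col_mx !linearB.
have A2d : enorm (A2 P *m (dsubmx xs - dsubmx (x 0%N))) ^+ 2 <=
    specnorm (A2 P) ^+ 2 * diameter (X2 P) ^+ 2.
  rewrite -exprMn lerXn2r ?nnegrE ?enorm_ge0 //.
    by rewrite mulr_ge0 ?specnorm_ge0 // (le_trans _ dX2) ?enorm_ge0.
  by apply: le_trans (enorm_mulmx _ _) _; rewrite ler_wpM2l ?specnorm_ge0.
have := ergodic_gap ls T Fxs Yys.
rewrite -/xbar -/ybar -/r lsr /potential.
have -> : lam 0%N = 0 by case: run.
rewrite add0r dotpNl dotpNr opprK -HE.
have qX := qnorm2_le (block_mx H1 0 0 H2) dX.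
have qY := qnorm2_le G dY.
have {}lsls : dotp ls ls / (2 * gamma) <= rho ^+ 2 / gamma / 2.
  by rewrite [2 * _]mulrC invfM mulrA !ler_pM2r ?invr_gt0.
have {}A2d := ler_wpM2l (ltW gamma_gt0) A2d.
rewrite ler_pdivlMr ?mulr_gt0 //; lra.
Qed.

End Run.

End Seg_admm.

(** * The convergence rate *)

Theorem theorem3p8 (R : realType) (d1 d2 d n : nat)
    (P : problem R d1 d2 d n) (Lx Ly gamma : R)
    (H1 : 'M[R]_d1) (H2 : 'M[R]_d2) (G : 'M[R]_d) :
  constraint_sets P -> slater P ->
  convexity_assumption P Lx -> lipschitz_assumption P Ly ->
  0 < gamma ->
  posdefmx H1 -> posdefmx H2 -> posdefmx G ->
  loewner_le ((Lx + Ly)%:M) H1 -> loewner_le ((Lx + Ly)%:M) H2 ->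
  loewner_le (Ly%:M) G ->
  (forall (x : nat -> 'cV[R]_(d1 + d2)) (y yh : nat -> 'cV[R]_d)
      (lam : nat -> 'cV[R]_n),
    seg_admm P gamma H1 H2 G x y yh lam ->
    forall T : nat, (1 <= T)%N ->
    forall rho : R, 0 < rho ->
    let xbar := ergodic_mean T x in
    let ybar := ergodic_mean T yh in
    exists M m : R,
      [/\ max_Phi P xbar M, min_Phi P ybar m &
        M - m + rho * enorm (residual P xbar) <=
          (rho ^+ 2 / gamma
           + gamma * specnorm (A2 P) ^+ 2 * diameter (X2 P) ^+ 2
           + specnorm (block_mx H1 0 0 H2) * diameterX P ^+ 2
           + specnorm G * diameter (Y P) ^+ 2) / (2 * T%:R)])
  /\
  (exists C : R,
    forall (x : nat -> 'cV[R]_(d1 + d2)) (y yh : nat -> 'cV[R]_d)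
      (lam : nat -> 'cV[R]_n),
    seg_admm P gamma H1 H2 G x y yh lam ->
    forall eps : R, 0 < eps <= 1 ->
    exists T : nat,
      [/\ (1 <= T)%N, T%:R <= C / eps &
        eps_saddle_point P eps (ergodic_mean T x) (ergodic_mean T yh)]).
Proof.
move=> sets slat conv lips g0 pH1 pH2 pG lH1 lH2 lG.
have [x0 Fx0] : exists x0, feasible P x0.
  have [xh [_ [/interior_subset Xxh _ Axh]]] := slat.
  by exists xh.
split=> [x y yh lam run [//|T] _ rho rho0|].
  exact: (ergodic_bound sets conv lips g0 pH1 pH2 pG lH1 lH2 lG run T rho0 Fx0).
have [c c0 cP] := slater_penalty sets conv slat.
have rho0 : 0 < c + 1 by rewrite ltr_wpDl.
pose N := (c + 1) ^+ 2 / gamma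
  + gamma * specnorm (A2 P) ^+ 2 * diameter (X2 P) ^+ 2
  + specnorm (block_mx H1 0 0 H2) * diameterX P ^+ 2
  + specnorm G * diameter (Y P) ^+ 2.
pose Q := `|N| / 2.
exists ((c + 1) * Q + 1) => x y yh lam run eps /andP[eps0 eps1].
(* [T.+1] is the least integer above [(c + 1) * Q / eps]. *)
pose T := Num.truncn ((c + 1) * Q / eps); exists T.+1.
have Q0 : 0 <= Q by rewrite divr_ge0.
have cQ0 : 0 <= (c + 1) * Q / eps by rewrite divr_ge0 ?mulr_ge0 ?addr_ge0 ?(ltW eps0).
split=> //.
  rewrite mulrDl mul1r -natr1 lerD ?invf_ge1 //.
  by rewrite truncn_le.
have T0 : 0 < T.+1%:R :> R by rewrite ltr0n.
have cQ : (c + 1) * (Q / T.+1%:R) <= eps.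
  rewrite mulrA ler_pdivrMr // [leRHS]mulrC -ler_pdivrMr //.
  exact/ltW/truncnS_gt.
have XP k : X P (x k) by exact: (run_X run).
have YP k : Y P (yh k.+1) by exact: (run_Yh run).
have Xb := ergodic_mean_in T (X_convex sets) (fun k => XP k.+1).
have Yb := ergodic_mean_in T (Y_convex sets) YP.
have [M [m [MP mP gap]]] :=
  ergodic_bound sets conv lips g0 pH1 pH2 pG lH1 lH2 lG run T rho0 Fx0.
have PhiM : Phi P (ergodic_mean T.+1 x) (ergodic_mean T.+1 yh) <= M.
  by case: MP => _; apply; exists (ergodic_mean T.+1 yh).
have := cP _ _ m Xb Yb mP.
set r := enorm _ in gap * => pen.
have r0 : 0 <= r by exact: enorm_ge0.
have {}gap : M - m + (c + 1) * r <= Q / T.+1%:R.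
  apply: le_trans gap _; rewrite -/N /Q invfM mulrA ler_pM2r ?invr_gt0 //.
  by rewrite ler_pM2r ?invr_gt0 // ler_norm.
have q0 : 0 <= Q / T.+1%:R by exact: divr_ge0 Q0 (ltW T0).
move: (Q / T.+1%:R) cQ gap q0 => q cQ gap q0.
have rq : r <= q by lra.
have crq := ler_wpM2l c0 rq; have cr0 := mulr_ge0 c0 r0.
have cq0 := mulr_ge0 c0 q0.
split=> //; last by rewrite -/r; lra.
by exists M, m; split=> //; apply/andP; split; lra.
Qed.
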